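(* Let $n$ be an integer. Let $A_n(q)$, $B_n(q)$ and $C_n(q)$ be respectively the generating functions, according to the area, of PPP's, marked PPP's and strips of semi-perimeter $n$; for example $$A_n(q):=\sum_{P\ \text{PPP},\ sp(P)=n} q^{area(P)},$$ where $sp$ denotes the semi-perimeter. Then the sequences of coefficients of $A_n(q)$, $B_n(q)$ and $C_n(q)$ are ultimately periodic. In all three cases, the period divides the least common multiple of the integers $i(n-i)$ for $i\in\{1,\dots,n-1\}$.
   Context: **PPP's.** A parallelogram polyomino is a finite set of unit cells of $\mathbb Z\times\mathbb Z$, defined up to translation, consisting of all cells contained between two lattice paths with unit North and East steps that intersect only at their common starting and ending points. Columns are ordered from left (first) to right (last). A periodic parallelogram polyomino (PPP) is a parallelogram polyomino $P$ together with a positive integer $g$, the gluing size, which is at most the minimum of the heights of the first and last columns of $P$; one excludes the PPP's of rectangular shape whose gluing size equals the height of the columns. The PPP is viewed on a cylinder: if $P$ has $H$ rows numbered from bottom to top, the $g$ top cells of the last column are glued to the $g$ bottom cells of the first column, so that row $H-g+i$ is continued on its right by row $i$ for $1\le i\le g$. Rows glued together count as the same row. The width is the number of columns, the height is the number of rows after gluing, i.e. $H-g$, the semi-perimeter is the sum of the height and the width, and the area is the number of cells of $P$. **Marked PPP's.** A marked PPP is a PPP with a marking of one of the horizontal edges of its first column which are above the gluing, including the one at the top of the gluing; i.e., if the first column has $h_1$ cells, one marks the horizontal edge at height $j$ above the bottom of the column for some $g\le j\le h_1$. Its semi-perimeter and area are those of the underlying PPP. **Strips.** The rotation of a PPP of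 width at least $2$ moves the first column to the right of the last column, at the position prescribed by the gluing (its bottom cell being placed in row $H-g+1$), the new gluing size being the number of rows common to the first two columns of the original PPP; for width $1$ the rotation is the identity. Rotation preserves width, height and area. A strip is an equivalence class (orbit) of PPP's under rotation; its semi-perimeter and area are those of any representative. The period of an ultimately periodic sequence $(a_m)$ is the least $T\ge1$ with $a_{m+T}=a_m$ for all large $m$. *)

(* Defs.v *)
From mathcomp Require Import all_boot finmap.
From mathcomp Require Import mathcomp_extra boolp classical_sets functions.
From mathcomp Require Import cardinality.

Set Implicit Arguments.
Unset Strict Implicit.
Unset Printing Implicit Defensive.

Local Open Scope fset_scope.
Local Open Scope nat_scope.

(** * Lattice paths and parallelogram polyominoes *)

(* A lattice path starts at the origin; [true] is a North step and [false] an
   East step. *)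
Definition lpath := seq bool.

Definition path_point (p : lpath) (i : nat) : nat * nat :=
  (count_mem false (take i p), count_mem true (take i p)).

Definition path_points (p : lpath) : seq (nat * nat) :=
  [seq path_point p i | i <- iota 0 (size p).+1].

Definition path_end (p : lpath) : nat * nat := path_point p (size p).

(* [u] is the upper path and [l] the lower one.  The conditions on the first
   steps say which is which, and discard [u = l] (the empty path or a single
   step, which bound no cell). *)
Definition bounding_paths (u l : lpath) : Prop :=
  [/\ ohead u = Some true, ohead l = Some false, path_end u = path_end l &
      forall v, v \in path_points u -> v \in path_points l ->
        v = (0, 0) \/ v = path_end u].

(* Heights of the successive East steps of a path starting at height [h]. *)
Fixpoint east_heights (h : nat) (p : lpath) : seq nat :=
  match p with
  | [::] => [::]
  | true :: p' => east_heights h.+1 p'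
  | false :: p' => h :: east_heights h p'
  end.

(* The cell [(x, y)] is the unit square [x, x+1] * [y, y+1]; it lies between
   the paths when it is above the East step of [l] and below the East step of
   [u] of abscissas [x, x+1].  For [x] beyond the end of the paths both heights
   default to [0], so no such cell qualifies. *)
Definition between (u l : lpath) (c : nat * nat) : bool :=
  nth 0 (east_heights 0 l) c.1 <= c.2 < nth 0 (east_heights 0 u) c.1.

(* Polyominoes are taken up to translation: the representative used here is the
   one whose bounding paths start at the origin. *)
Definition polyomino := {fset nat * nat}.

Definition is_parallelogram (P : polyomino) : Prop :=
  exists u l, bounding_paths u l /\ forall c, (c \in P) = between u l c.

Definition ncols (P : polyomino) : nat := #|` [fset c.1 | c in P]|.
Definition nrows (P : polyomino) : nat := #|` [fset c.2 | c in P]|.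

(* The rows met by column [x], the first column being column [0]. *)
Definition column (P : polyomino) (x : nat) : {fset nat} :=
  [fset c.2 | c in [fset c in P | c.1 == x]].

Definition col_height (P : polyomino) (x : nat) : nat := #|` column P x|.

Definition is_rectangle (P : polyomino) (w h : nat) : Prop :=
  forall c, (c \in P) = (c.1 < w) && (c.2 < h).

(** * Periodic parallelogram polyominoes *)

(* A polyomino together with a gluing size. *)
Definition glued := (polyomino * nat)%type.

Definition is_ppp (X : glued) : Prop :=
  let: (P, g) := X in
  [/\ is_parallelogram P, 0 < g,
      g <= minn (col_height P 0) (col_height P (ncols P).-1) &
      ~ exists w h, is_rectangle P w h /\ g = h].

Definition width (X : glued) : nat := ncols X.1.
Definition height (X : glued) : nat := nrows X.1 - X.2.
Definition semi_perimeter (X : glued) : nat := height X + width X.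
Definition area (X : glued) : nat := #|` X.1|.

(* [(X, j)]: the marked edge is at height [j] above the bottom of the first
   column. *)
Definition is_marked_ppp (Y : glued * nat) : Prop :=
  is_ppp Y.1 /\ Y.1.2 <= Y.2 <= col_height Y.1.1 0.

(** * Rotation and strips *)

(* The initial value of the iterated minimum is an upper bound of the set, so it
   is irrelevant for nonempty [A]. *)
Definition fset_min (A : {fset nat}) : nat :=
  \big[minn/(\max_(y <- A) y)]_(y <- A) y.

(* Translate so that the first column is column [0] and the lowest row row [0]. *)
Definition to_origin (P : polyomino) : polyomino :=
  let x0 := fset_min [fset c.1 | c in P] in
  let y0 := fset_min [fset c.2 | c in P] in
  [fset (c.1 - x0, c.2 - y0) | c in P].

(* The first column of a parallelogram polyomino starts in row [0]; its bottom
   cell is moved to the row of index [nrows P - g], counted from [0]. *)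
Definition rotation (X : glued) : glued :=
  let: (P, g) := X in
  if ncols P <= 1 then X else
  let others := [fset c in P | c.1 != 0] in
  let moved := [fset (ncols P, nrows P - g + y) | y in column P 0] in
  (to_origin (others `|` moved), #|` column P 0 `&` column P 1|).

Definition orbit_of (X : glued) : set glued :=
  [set Y | exists k, Y = iter k rotation X]%classic.

(** * Objects of given semi-perimeter and area *)

Definition ppps (n m : nat) : set glued :=
  [set X | [/\ is_ppp X, semi_perimeter X = n & area X = m]]%classic.

Definition marked_ppps (n m : nat) : set (glued * nat) :=
  [set Y | [/\ is_marked_ppp Y, semi_perimeter Y.1 = n & area Y.1 = m]]%classic.

Definition strips (n m : nat) : set (set glued) :=
  [set O | exists2 X, ppps n m X & O = orbit_of X]%classic.

(** * Coefficients of generating functions and ultimate periodicity *)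

(* [a m] is the number of objects of area [m], where [S m] is the set of these
   objects; in particular each [S m] is finite.  This determines [a]. *)
Definition gf_coefs (T : Type) (S : nat -> set T) (a : nat -> nat) : Prop :=
  forall m, (S m #= `I_(a m))%card.

Definition eventual_period (a : nat -> nat) (T : nat) : Prop :=
  0 < T /\ exists M, forall m, M <= m -> a (m + T) = a m.

Definition ultimately_periodic (a : nat -> nat) : Prop :=
  exists T, eventual_period a T.

Definition is_period (a : nat -> nat) (T : nat) : Prop :=
  eventual_period a T /\ forall T', eventual_period a T' -> T <= T'.

Definition lcm_products (n : nat) : nat :=
  \big[lcmn/1]_(1 <= i < n) (i * (n - i)).

(* Main.v *)
Require Import Defs.
From mathcomp Require Import all_boot finmap zify.
From mathcomp Require Import boolp classical_sets functions cardinality.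

Set Implicit Arguments.
Unset Strict Implicit.
Unset Printing Implicit Defensive.

Local Open Scope fset_scope.
Local Open Scope nat_scope.

(** Unrolling the cylinder turns a PPP of width [w] and height [h] into a
bi-infinite staircase-shaped band.  Its column [i] occupies the rows from
[l i] to [u i - 1], where [l] and [u] are nondecreasing, increase by [h] over
[w] columns, and satisfy [l (i + 1) < u i] because consecutive columns share a
row.  The gluing condition is this same overlap between the columns [w - 1]
and [w], so a PPP of width [w] and height [h] is nothing but such a band with
a chosen first column ([pppP]); the excluded rectangles are the case [h = 0].
Rotation moves the chosen column one step along the band ([rotation_window]).

Raising the upper boundary by [s] gives again a band, with the same [w] and
[h]: all columns, and the gluing, gain [s] cells, the area grows by [s * w],
the marks of the first column move up by [s], and rotation is respected.  If
[L] is a multiple of every possible width, the choice [s = L / w] adds exactly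
[L] to the area, whatever the width; this map, [stretch L], is injective.  It
also reaches every PPP of semi-perimeter [n] and area [m + L] as soon as [m] is
large ([ppps_shrink]): within one period both boundaries vary by at most [h],
so all columns have comparable heights, and a large area forces all of them to
be tall enough for lowering the upper boundary.  Hence the numbers of PPP's, of
marked PPP's and of strips of areas [m] and [m + L] agree for large [m].

For [L] one takes the least common multiple of the [i * (n - i)]: a width [w]
satisfies [0 < w < n] since the height [n - w] is positive, so [w] divides
[w * (n - w)], hence [L].  Finally, the least eventual period of a sequence
divides every eventual period. *)

(** * Lattice paths and their East steps *)

Lemma size_east_heights h p : size (east_heights h p) = count_mem false p.
Proof. by elim: p h => [|[] p IHp] h //=; rewrite IHp ?add0n ?add1n. Qed.

Lemma path_endE (p : lpath) : path_end p = (count_mem false p, count_mem true p).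
Proof. by rewrite /path_end /path_point take_size. Qed.

Lemma east_heights_path h p :
  path leq h (rcons (east_heights h p) (h + count_mem true p)).
Proof.
elim: p h => [|[] p IHp] h /=; first by rewrite addn0 leqnn.
- rewrite addnA addn1; case: (east_heights _ p) (IHp h.+1) => [|a e] /=.
    by move=> /andP[/ltnW -> _].
  by case/andP=> /ltnW -> ->.
- by rewrite leqnn add0n IHp.
Qed.

(** Every nondecreasing list is the list of East heights of a path: climb to
each prescribed height, step East, and finish with the missing North steps. *)
Lemma exists_path_east_heights h e N : path leq h (rcons e N) ->
  exists p, east_heights h p = e /\ h + count_mem true p = N.
Proof.
have climb k h' q : east_heights h' (nseq k true ++ q) = east_heights (k + h') q.
  by elim: k h' => [|k IHk] h' //=; rewrite IHk addnS.
elim: e h => [|a e IHe] h /=.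
  rewrite andbT => hN; exists (nseq (N - h) true).
  split; last by rewrite count_nseq /= mul1n subnKC.
  by rewrite -[nseq _ _]cats0 climb.
case/andP=> ha /IHe [p [pe pN]].
exists (nseq (a - h) true ++ false :: p); split.
  by rewrite climb /= subnK // pe.
by rewrite count_cat count_nseq /= mul1n add0n addnA subnKC.
Qed.

(** Starting the path at an arbitrary height [h] is what makes an induction on
the path possible. *)
Lemma mem_path_points_from h (p : lpath) x y :
  (exists2 i, i <= size p &
     x = count_mem false (take i p) /\ y = h + count_mem true (take i p)) <->
  [/\ x <= count_mem false p, nth 0 (h :: east_heights h p) x <= y &
      y <= nth 0 (rcons (east_heights h p) (h + count_mem true p)) x].
Proof.
elim: p h x y => [|b p IHp] h x y /=.
  split=> [[i _ [-> ->]]|]; first by rewrite /= addn0 leqnn.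
  case; rewrite leqn0 => /eqP -> /=; rewrite addn0 => hy yh.
  by exists 0 => //=; split=> //; lia.
case: b => /=.
  have /= [] := IHp h.+1 x y; rewrite addSn => to from.
  split=> [[[|i] ilt []]|[xle yge yle]].
  - move=> /= -> ->; rewrite addn0; split=> //=.
    have := east_heights_path h (true :: p) => /=; rewrite addnA addn1.
    by case: (east_heights _ _) => [|a e] /= /andP[].
  - move=> /= xE yE; case: to; first by exists i => //; split => //; lia.
    move=> ? ley ?; split; [lia| |by rewrite add1n addnS].
    by case: (x) ley => //= /ltnW.
  - case: (ltnP (nth 0 (h :: east_heights h.+1 p) x) y) => ylt.
      case: from => [|i ile [-> yE]].
        rewrite add1n addnS in yle; split=> //.
        by case: (x) ylt => [|x'] //= /ltnW.
      by exists i.+1 => //=; split=> //; lia.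
    case: x {to} xle yle yge ylt from => [|x] xle yle yge ylt from.
      by exists 0 => //=; split=> //; move: yge ylt => /=; lia.
    case: from => [|i ile [xE yE]].
      by rewrite add1n addnS in yle; split=> //; lia.
    by exists i.+1 => //=; rewrite xE; split=> //; lia.
case: x => [|x] /=.
  split=> [[[|i] ilt []]|[_ hy yh]] //=; try lia.
    by move=> _ ->; rewrite addn0.
  by exists 0 => //=; lia.
have /= [to from] := IHp h x y; rewrite !add1n ltnS.
split=> [[[|i] ilt []]|] //=.
  by move=> xE yE; apply: to; exists i => //; lia.
rewrite add0n; case/from=> i ile [-> ->]; exists i.+1 => //=; lia.
Qed.

(** A path meets the vertical line of abscissa [x] in an interval, from the
height of the East step arriving on that line to that of the one leaving it. *)
Lemma mem_path_points (p : lpath) v : v \in path_points p <->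
  [/\ v.1 <= count_mem false p, nth 0 (0 :: east_heights 0 p) v.1 <= v.2 &
      v.2 <= nth 0 (rcons (east_heights 0 p) (count_mem true p)) v.1].
Proof.
have := mem_path_points_from 0 p v.1 v.2; rewrite add0n => <-; split.
  case/mapP=> i; rewrite mem_iota add0n ltnS => /andP[_ ile] ->.
  by exists i.
case=> i ile [xE yE]; apply/mapP; exists i; first by rewrite mem_iota ltnS.
by case: v xE yE => ? ? /= -> ->.
Qed.

(** * Column profiles of parallelogram polyominoes *)

(** For [i < w], [l i] and [u i] are the heights of the [i]-th East steps of the
lower and upper bounding paths of [P]. *)
Record column_profile (w : nat) (l u : nat -> nat) (P : polyomino) : Prop :=
  ColumnProfile {
    cp_gt0 : 0 < w;
    cp_l0 : l 0 = 0;
    cp_l : forall i, i.+1 < w -> l i <= l i.+1;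
    cp_u : forall i, i.+1 < w -> u i <= u i.+1;
    cp_lu : forall i, i.+1 < w -> l i.+1 < u i;
    cp_last : l w.-1 < u w.-1;
    cp_mem : forall c, (c \in P) = (c.1 < w) && (l c.1 <= c.2 < u c.1) }.

Lemma east_heights_le p i : i.+1 < count_mem false p ->
  nth 0 (east_heights 0 p) i <= nth 0 (east_heights 0 p) i.+1.
Proof.
move=> iw; have /pathP := east_heights_path 0 p.
move=> /(_ 0 i.+1); rewrite size_rcons size_east_heights => /(_ (ltnW iw)) /=.
by rewrite !nth_rcons size_east_heights iw (ltnW iw).
Qed.

(** On each vertical line [x = i + 1] strictly between the two ends, the paths
trace the intervals from [l i] to [l (i + 1)] and from [u i] to [u (i + 1)], so
not meeting there means that [l (i + 1) < u i], provided that the lower path is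
the lower one at column [i]: an induction on the columns. *)
Lemma parallelogram_profile P :
  is_parallelogram P <-> exists w l u, column_profile w l u P.
Proof.
split.
  case=> pu [pl] [[hu hl ends meet] memP].
  move: (ends); rewrite !path_endE => -[wE NE].
  set w := count_mem false pu in wE.
  have sz_u : size (east_heights 0 pu) = w by rewrite size_east_heights.
  have sz_l : size (east_heights 0 pl) = w by rewrite size_east_heights.
  pose l := nth 0 (east_heights 0 pl); pose u := nth 0 (east_heights 0 pu).
  have w_gt0 : 0 < w by rewrite wE; case: (pl) hl => [|[] q] //=; rewrite add1n.
  have l0 : l 0 = 0 by rewrite /l; case: (pl) hl => [|[] q].
  have u0 : 0 < u 0.
    move: w_gt0; rewrite /u /w; case: (pu) hu => [|[] q] //= _.
    have := east_heights_path 1 q; rewrite add0n -(size_east_heights 1).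
    by case: (east_heights 1 q) => [|a e] //= /andP[].
  have lP i : i.+1 < w -> l i <= l i.+1 by rewrite wE; apply: east_heights_le.
  have uP i : i.+1 < w -> u i <= u i.+1 by apply: east_heights_le.
  (* otherwise the two paths meet at the point [(i.+1, u i)] *)
  have step i : i.+1 < w -> l i < u i -> l i.+1 < u i.
    move=> iw lu; rewrite ltnNge; apply/negP => ul.
    case: (meet (i.+1, u i)).
    - apply/mem_path_points; split=> /=; [exact: ltnW|exact: leqnn|].
      by rewrite nth_rcons sz_u iw uP.
    - apply/mem_path_points; split=> /=; [by rewrite -wE ltnW|exact: ltnW|].
      by rewrite nth_rcons sz_l iw.
    - by [].
    - by rewrite path_endE => -[iE _]; rewrite iE ltnn in iw.
  have lu i : i < w -> l i < u i.
    elim: i => [|i IHi] iw; first by rewrite l0.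
    by apply: leq_trans (step _ iw (IHi (ltnW iw))) (uP _ iw).
  exists w, l, u; split=> //.
  - by move=> i iw; apply: step => //; apply/lu/ltnW.
  - by apply: lu; rewrite prednK.
  - move=> c; rewrite memP /between -/(l _) -/(u _).
    case: (ltnP c.1 w) => //= wc.
    by rewrite /u [X in _ < X]nth_default ?sz_u // andbF.
case=> w [l [u [w_gt0 l0 lP uP luP last_lu memP]]].
have mono f k : (forall i, i.+1 < w -> f i <= f i.+1) -> f w.-1 <= k ->
    path leq 0 (rcons (mkseq f w) k).
  move=> fP fk; apply/(pathP 0) => i; rewrite size_rcons size_mkseq ltnS => iw.
  rewrite nth_rcons size_mkseq; case: i iw => [|i] iw //=.
  rewrite nth_rcons size_mkseq iw nth_mkseq //.
  case: (ltngtP i.+1 w) iw => // iw _; first by rewrite nth_mkseq // fP.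
  by move: fk; rewrite -iw.
(* both paths are made to end at the top [u w.-1] of the last column *)
have [pu [euE NuE]] := exists_path_east_heights (mono u _ uP (leqnn _)).
have [pl [elE NlE]] := exists_path_east_heights (mono l _ lP (ltnW last_lu)).
rewrite !add0n in NuE NlE.
have wu : count_mem false pu = w by rewrite -(size_east_heights 0) euE size_mkseq.
have wl : count_mem false pl = w by rewrite -(size_east_heights 0) elE size_mkseq.
have u_gt0 : 0 < u 0.
  case: (ltnP 1 w) => w1; first by have := luP 0 w1; lia.
  have -> : 0 = w.-1 by lia.
  lia.
exists pu, pl; split.
  split.
  - have := congr1 (nth 0 ^~ 0) euE; rewrite nth_mkseq //.
    case: (pu) => [|[] q] //=; lia.
  - have := congr1 (nth 0 ^~ 0) elE; rewrite nth_mkseq // l0.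
    case: (pl) wl => [|[] q] //= wl; first by move: wl w_gt0 => /= <-.
    move=> e0; have := east_heights_path 1 q.
    rewrite add0n -(size_east_heights 1) in wl; rewrite -wl in w_gt0.
    by case: (east_heights 1 q) w_gt0 e0 => [|a e] //= _ ->.
  - by rewrite !path_endE wu wl NuE NlE.
  - case=> x y /mem_path_points[/= xw + +] /mem_path_points[/= _ _].
    rewrite path_endE euE elE wu NuE NlE in xw *.
    rewrite !nth_rcons !size_mkseq; case: x xw => [|x] /= xw; rewrite ?w_gt0.
      by rewrite !nth_mkseq // l0 leqn0 => _ _ /eqP ->; left.
    rewrite nth_mkseq //; case: (ltngtP x.+1 w) xw => // xw _.
      by rewrite !nth_mkseq //; have := luP _ xw; lia.
    move: (xw) => <- /= uy yu _; right; congr (_, _).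
    by apply/eqP; rewrite eqn_leq yu uy.
move=> c; rewrite memP /between euE elE.
case: (ltnP c.1 w) => wc /=; first by rewrite !nth_mkseq.
by rewrite [X in _ < X]nth_default ?size_mkseq // andbF.
Qed.

Lemma card_interval (A : {fset nat}) a b :
  (forall y, (y \in A) = (a <= y < b)) -> #|` A| = b - a.
Proof.
move=> memA.
have -> : #|` A| = size (iota a (b - a)).
  apply: perm_size; apply: uniq_perm; [exact: fset_uniq|exact: iota_uniq|].
  by move=> y; rewrite memA mem_iota; lia.
by rewrite size_iota.
Qed.

Lemma mem_column (P : polyomino) x y : (y \in column P x) = ((x, y) \in P).
Proof.
apply/imfsetP/idP => [[[a b]]|xyP].
  by rewrite !inE /= => /andP[abP /eqP <-] ->.
by exists (x, y); rewrite // !inE xyP eqxx.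
Qed.

Lemma leq_homo_below w (f : nat -> nat) :
    (forall i, i.+1 < w -> f i <= f i.+1) ->
  forall i j, i <= j < w -> f i <= f j.
Proof.
move=> fP i j; elim: j => [|j IHj]; first by case: i.
case/andP; rewrite leq_eqVlt => /predU1P[->//|ij] jw.
by apply: leq_trans (fP _ jw); apply: IHj; rewrite (ltnW jw) andbT.
Qed.

Lemma leq_homo (f : nat -> nat) :
  (forall i, f i <= f i.+1) -> forall i j, i <= j -> f i <= f j.
Proof. by move=> fP i j; apply: (homo_leq leqnn leq_trans fP). Qed.

Section ColumnProfile.

Variables (w : nat) (l u : nat -> nat) (P : polyomino).
Hypothesis cp : column_profile w l u P.

Let last_lt : w.-1 < w. Proof. by rewrite prednK // (cp_gt0 cp). Qed.

Lemma profile_lt i : i < w -> l i < u i.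
Proof.
move=> iw; case: (ltnP i.+1 w) => [i1w|wi].
  exact: leq_ltn_trans (cp_l cp i1w) (cp_lu cp i1w).
have iE : i = w.-1 by lia.
by rewrite iE; apply: cp_last cp.
Qed.

Lemma mem_profile x y : ((x, y) \in P) = (x < w) && (l x <= y < u x).
Proof. exact: cp_mem cp (x, y). Qed.

Lemma ncols_profile : ncols P = w.
Proof.
rewrite /ncols (@card_interval _ 0 w) ?subn0 // => x.
apply/imfsetP/idP => [[c]|/= xw]; last first.
  by exists (x, l x); rewrite //= mem_profile xw leqnn profile_lt.
by rewrite /= (cp_mem cp) => /andP[? _] ->.
Qed.

Lemma nrows_profile : nrows P = u w.-1.
Proof.
rewrite /nrows (@card_interval _ 0 (u w.-1)) ?subn0 // => y.
apply/imfsetP/idP => [[[x z]]|/= yu].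
  rewrite /= mem_profile => /and3P[xw _ zu] ->.
  apply: leq_trans zu _; apply: (leq_homo_below (cp_u cp)).
  by move: last_lt; lia.
(* the first column reaching above [y] also starts at or below [y] *)
have ex : exists x, y < u x by exists w.-1.
case: (ex_minnP ex) => x yx xmin.
have xw : x < w by apply: leq_ltn_trans (xmin _ yu) last_lt.
exists (x, y) => //=; rewrite mem_profile xw yx andbT /=.
case: x xw xmin yx => [|x] xw xmin _; first by rewrite (cp_l0 cp).
rewrite leqNgt; apply/negP => ylx; have := xmin x.
by rewrite ltnn => /(_ (ltn_trans ylx (cp_lu cp xw))).
Qed.

Lemma col_height_profile x : x < w -> col_height P x = u x - l x.
Proof.
by move=> xw; apply: card_interval => y; rewrite mem_column mem_profile xw.
Qed.

Lemma area_profile : #|` P| = \sum_(0 <= x < w) (u x - l x).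
Proof.
pose s := [seq (x, y) | x <- iota 0 w, y <- iota (l x) (u x - l x)].
have -> : #|` P| = size s.
  apply: perm_size; apply: uniq_perm; first exact: fset_uniq.
    apply: allpairs_uniq_dep => [|x _|]; try exact: iota_uniq.
    by move=> [a b] [a' b'] _ _ /= [-> ->].
  move=> [x y]; rewrite mem_profile; apply/idP/allpairsPdep.
    move=> xy; exists x, y; rewrite !mem_iota; split=> //; lia.
  by case=> x' [y' []]; rewrite !mem_iota => ? ? [-> ->]; lia.
rewrite size_allpairs_dep sumnE big_map /index_iota subn0.
by apply: eq_bigr => x _; rewrite size_iota.
Qed.

End ColumnProfile.

(** * Bands: the universal cover of a periodic parallelogram polyomino *)

(** The lower and upper boundaries of a PPP unrolled along the cylinder, from
column [0] onwards. *)
Record band (w h : nat) (l u : nat -> nat) : Prop := Band {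
  band_w : 0 < w;
  band_h : 0 < h;
  band_l0 : l 0 = 0;
  band_l : forall i, l i <= l i.+1;
  band_u : forall i, u i <= u i.+1;
  band_lu : forall i, l i.+1 < u i;
  band_lper : forall i, l (i + w) = l i + h;
  band_uper : forall i, u (i + w) = u i + h }.

(** [X] is cut out of the band by its first [w] columns.  Row [h] is the bottom
row of column [w], that is, the image of row [0] after one turn around the
cylinder, so the gluing consists of the rows of column [w - 1] from [h] on. *)
Definition window (w h : nat) (l u : nat -> nat) (X : glued) : Prop :=
  X.2 = u w.-1 - h /\
  forall x y, ((x, y) \in X.1) = (x < w) && (l x <= y < u x).

Lemma window_inj w h l u X Y : window w h l u X -> window w h l u Y -> X = Y.
Proof.
case: X Y => [P g] [Q g'] [/= -> memP] [/= -> memQ]; congr (_, _).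
by apply/fsetP => -[x y]; rewrite memP memQ.
Qed.

Lemma window_profile w h l u X :
  band w h l u -> window w h l u X -> column_profile w l u X.1.
Proof.
case=> w_gt0 h_gt0 l0 lP uP lu _ _ [_ memX]; split=> //.
- by apply: leq_ltn_trans (lP _) (lu _).
- by case=> x y; rewrite memX.
Qed.

Section Window.

Variables (w h : nat) (l u : nat -> nat) (X : glued).
Hypotheses (bd : band w h l u) (win : window w h l u X).

Let cp := window_profile bd win.

Lemma band_lw : l w = h.
Proof. by rewrite -[w]add0n (band_lper bd) (band_l0 bd). Qed.

Lemma band_uw : u w = u 0 + h.
Proof. by rewrite -[w]add0n (band_uper bd). Qed.

Lemma band_glue : h < u w.-1.
Proof. by have := band_lu bd w.-1; rewrite prednK ?(band_w bd) // band_lw. Qed.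

Lemma width_window : width X = w.
Proof. exact: ncols_profile cp. Qed.

Lemma semi_perimeter_window : semi_perimeter X = h + w.
Proof.
rewrite /semi_perimeter width_window /height (nrows_profile cp) win.1.
by have := band_glue; lia.
Qed.

Lemma area_window : area X = \sum_(0 <= x < w) (u x - l x).
Proof. exact: area_profile cp. Qed.

Lemma is_ppp_window : is_ppp X.
Proof.
have := bd; have := win; have := cp.
case: X => [P g] /= cpP [/= gE memP] [w_gt0 h_gt0 l0 lP uP lu lper uper].
have gl := band_glue; have lw := band_lw; have uw := band_uw.
split.
- by apply/parallelogram_profile; exists w, l, u.
- by rewrite gE; lia.
- rewrite (ncols_profile cpP) !(col_height_profile cpP) ?prednK // gE l0.
  have := uP w.-1; have := lP w.-1; rewrite prednK //; lia.
- case=> w' [h' [rect gh]]; have := rect (w.-1, (u w.-1).-1).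
  have lt := lu w.-1; have le := lP w.-1.
  rewrite memP /= prednK // leqnn; lia.
Qed.

End Window.

(** The extension of [f], given on the columns below [w], that increases by [h]
at each turn around the cylinder. *)
Definition unroll (w h : nat) (f : nat -> nat) (i : nat) : nat :=
  f (i %% w) + i %/ w * h.

Lemma unroll_small w h f i : i < w -> unroll w h f i = f i.
Proof. by move=> iw; rewrite /unroll modn_small // divn_small // addn0. Qed.

Lemma unroll_period w h f i : 0 < w -> unroll w h f (i + w) = unroll w h f i + h.
Proof.
move=> w_gt0; rewrite /unroll modnDr divnDr // divnn w_gt0 addn1 mulSn.
by rewrite addnA addnAC.
Qed.

(** A translation-invariant relation between consecutive columns needs to be
checked only inside one period and across its end.  The three inequalities that
define a band are instances. *)
Lemma unroll_rel w h (R : rel nat) f g : 0 < w ->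
    (forall a b c, R a b -> R (a + c) (b + c)) ->
    (forall k, k.+1 < w -> R (f k) (g k.+1)) -> R (f w.-1) (g 0 + h) ->
  forall i, R (unroll w h f i) (unroll w h g i.+1).
Proof.
move=> w_gt0 Radd Rin Rlast i; rewrite /unroll.
set k := i %% w; set q := i %/ w.
have kw : k < w by rewrite ltn_pmod.
have -> : i.+1 = q * w + k.+1 by rewrite addnS -divn_eq.
rewrite modnMDl divnMDl //; case: (ltnP k.+1 w) => k1w.
  by rewrite modn_small // divn_small // addn0; apply/Radd/Rin.
have -> : k.+1 = w by apply/eqP; rewrite eqn_leq kw.
have -> : k = w.-1 by lia.
rewrite modnn divnn w_gt0 addn1 mulSn addnA; exact: Radd.
Qed.

(** Unrolled with [h = u (w - 1) - g], the bounds of the gluing size by the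
heights of the last and of the first column say that [l] and [u] remain
nondecreasing from column [w - 1] to column [w], and its positivity says that
these two columns overlap. *)
Lemma pppP X : is_ppp X <->
  exists w h l u, band w h l u /\ window w h l u X.
Proof.
split; last by case=> w [h [l [u [bd win]]]]; apply: is_ppp_window bd win.
case: X => [P g] [/parallelogram_profile[w [l [u cp]]] g_gt0 gle notrect].
have w_gt0 := cp_gt0 cp; have last_lt : w.-1 < w by rewrite prednK.
move: gle; rewrite (ncols_profile cp) !(col_height_profile cp) // (cp_l0 cp).
rewrite subn0 leq_min => /andP[g_first g_last].
have homo := @leq_homo_below w.
(* a gluing as high as the polyomino would force all columns to be full *)
have g_lt : g < u w.-1.
  rewrite ltnNge; apply/negP => le_g; apply: notrect; exists w, g; split=> //.
  case=> x y; rewrite (mem_profile cp) /=; case: (ltnP x w) => //= xw.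
  have xlast : x <= w.-1 < w by lia.
  have := homo _ (cp_l cp) x _ xlast; have := homo _ (cp_u cp) x _ xlast.
  by have := homo _ (cp_u cp) 0 x xw; lia.
have := cp_last cp => l_last.
exists w, (u w.-1 - g), (unroll w (u w.-1 - g) l), (unroll w (u w.-1 - g) u).
split; last first.
  split=> [|x y] /=; first by rewrite unroll_small //; lia.
  rewrite (mem_profile cp); case: (ltnP x w) => //= xw.
  by rewrite !unroll_small.
split=> //.
- lia.
- by rewrite unroll_small // (cp_l0 cp).
- apply: (unroll_rel (R := leq)) => // [a b c|k k1w|]; first by rewrite leq_add2r.
    exact: cp_l cp _ k1w.
  by rewrite (cp_l0 cp); lia.
- apply: (unroll_rel (R := leq)) => // [a b c|k k1w|]; first by rewrite leq_add2r.
    exact: cp_u cp _ k1w.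
  lia.
- apply: (unroll_rel (R := fun a b => b < a)) => // [a b c|k k1w|].
  + by rewrite ltn_add2r.
  + exact: cp_lu cp _ k1w.
  by rewrite (cp_l0 cp); lia.
- by move=> i; apply: unroll_period.
- by move=> i; apply: unroll_period.
Qed.

(** * Rotation as a move along the band *)

Lemma fset_min_eq (A : {fset nat}) a :
  a \in A -> (forall y, y \in A -> a <= y) -> fset_min A = a.
Proof.
move=> aA lowA; apply/eqP; rewrite eqn_leq /fset_min; apply/andP; split.
  have: a \in enum_fset A by [].
  elim: (enum_fset A) (\max_(_ <- _) _) => // b s IHs m.
  rewrite inE big_cons => /predU1P[<-|/IHs le_a]; first exact: geq_minl.
  exact: leq_trans (geq_minr _ _) (le_a _).
rewrite big_seq; apply: (big_ind (leq a)) => [|x y ax ay|y yA].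
- exact: leq_bigmax_seq aA isT.
- by rewrite leq_min ax.
- exact: lowA.
Qed.

(** With [c = l 1], the boundary [f] of a band as seen from the bottom of column
[1], which becomes the new origin. *)
Definition next_col (c : nat) (f : nat -> nat) (i : nat) : nat := f i.+1 - c.

Lemma band_next w h l u : band w h l u ->
  band w h (next_col (l 1) l) (next_col (l 1) u).
Proof.
case=> w_gt0 h_gt0 l0 lP uP lu lper uper.
have lle i : l 1 <= l i.+1 by apply: leq_homo.
rewrite /next_col; split=> // [|i|i|i|i|i]; first by rewrite subnn.
- exact: leq_sub2r.
- exact: leq_sub2r.
- by have := lu i.+1; have := lle i.+1; lia.
- by rewrite -addSn lper; have := lle i; lia.
- by rewrite -addSn uper; have := lle i; have := lu i.+1; have := lP i.+1; lia.
Qed.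

(** [Q] consists of the columns [1] to [w] of the band: its corner is
[(1, l 1)]. *)
Lemma to_originP (Q : polyomino) w l u : 0 < w ->
    (forall i, l i <= l i.+1) -> (forall i, l i < u i) ->
    (forall x y, ((x, y) \in Q) = (0 < x <= w) && (l x <= y < u x)) ->
  forall x y, ((x, y) \in to_origin Q) =
    (x < w) && (next_col (l 1) l x <= y < next_col (l 1) u x).
Proof.
move=> w_gt0 lP lu memQ.
have x0 : fset_min [fset c.1 | c in Q] = 1.
  apply: fset_min_eq => [|x /imfsetP[[a b] /=]].
    by apply/imfsetP; exists (1, l 1); rewrite //= memQ w_gt0 !leqnn lu.
  by rewrite memQ => /andP[/andP[? _] _] ->.
have y0 : fset_min [fset c.2 | c in Q] = l 1.
  apply: fset_min_eq => [|x /imfsetP[[a b] /=]].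
    by apply/imfsetP; exists (1, l 1); rewrite //= memQ w_gt0 !leqnn lu.
  rewrite memQ => /andP[/andP[a_gt0 _] /andP[lab _]] ->.
  by apply: leq_trans lab; apply: leq_homo.
move=> x y; rewrite /to_origin x0 y0 /next_col; apply/imfsetP/idP.
  case=> -[a b] /=; rewrite memQ => mem [-> ->]; case: a mem => // a.
  by rewrite subn1 /=; have := leq_homo lP (ltn0Sn a); lia.
have := leq_homo lP (ltn0Sn x) => lx xy.
exists (x.+1, y + l 1) => /=; first by rewrite memQ; lia.
by rewrite subn1 addnK.
Qed.

(** The first column, moved up by [nrows P - g = h], is column [w] of the band,
and the rows common to columns [0] and [1] go from [l 1] to [u 0 - 1]: this is,
one turn lower, the overlap of columns [w] and [w + 1]. *)
Lemma rotation_window w h l u X : band w h l u -> window w h l u X ->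
  window w h (next_col (l 1) l) (next_col (l 1) u) (rotation X).
Proof.
move=> bd win; have cp := window_profile bd win.
have ncP := ncols_profile cp; have nrP := nrows_profile cp.
have gl := band_glue bd; have lw := band_lw bd; have uw := band_uw bd.
have [w_gt0 h_gt0 l0 lP uP lu lper uper] := bd.
case: X win cp ncP nrP => [P g] [/= gE memP] cp ncP nrP.
rewrite ncP; case: (leqP w 1) => w1.
  have wE : w = 1 by lia.
  rewrite /next_col /window wE /= in lw uw *; rewrite wE /= in memP gE.
  split; first by rewrite gE lw uw addnK.
  move=> [|x] y; rewrite memP //= subnn l0 uw lw addnK.
  by [].
have memcol x y : (y \in column P x) = (x < w) && (l x <= y < u x).
  by rewrite mem_column memP.
have lu' i : l i < u i by apply: leq_ltn_trans (lu i).
split=> /=.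
  rewrite (@card_interval _ (l 1) (u 0)) => [|y].
    by rewrite /next_col prednK // uw subnAC addnK.
  by rewrite inE !memcol w1 w_gt0 l0 /=; have := uP 0; lia.
apply: to_originP => // x y; rewrite !inE /= memP nrP gE.
have ugh : u w.-1 - (u w.-1 - h) = h by lia.
rewrite ugh; apply/orP/idP.
  case=> [|/imfsetP[z]]; first by lia.
  rewrite /= memcol l0 /= w_gt0 => zu [-> ->].
  by rewrite w_gt0 leqnn lw uw /=; lia.
case/andP=> /andP[x_gt0]; rewrite leq_eqVlt => /predU1P[->|xw] xy.
  right; apply/imfsetP; exists (y - h); last by congr (_, _); lia.
  by rewrite /= memcol w_gt0 l0 /=; lia.
by left; lia.
Qed.

Lemma is_ppp_rotation X : is_ppp X -> is_ppp (rotation X).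
Proof.
case/pppP=> w [h [l [u [bd win]]]].
exact: is_ppp_window (band_next bd) (rotation_window bd win).
Qed.

(** * Thickening all columns by the same amount *)

(** The union of the upward translates of [X] by [0], ..., [s]; this form makes
no reference to a band. *)
Definition thicken (s : nat) (X : glued) : glued :=
  ([fset ((c.1, c.2 + t) : nat * nat) | c in X.1, t in iota 0 s.+1], X.2 + s).

(** The inverse of [thicken] on the polyominoes with sufficiently tall columns. *)
Definition erode (s : nat) (X : glued) : glued :=
  ([fset c in X.1 | (c.1, c.2 + s) \in X.1], X.2 - s).

Lemma band_thicken s w h l u : band w h l u -> band w h l (fun i => u i + s).
Proof.
case=> w_gt0 h_gt0 l0 lP uP lu lper uper; split=> // i.
- by rewrite leq_add2r.
- exact: leq_trans (lu i) (leq_addr _ _).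
- by rewrite uper addnAC.
Qed.

Lemma window_thicken s w h l u X : band w h l u -> window w h l u X ->
  window w h l (fun i => u i + s) (thicken s X).
Proof.
move=> bd [gE memX]; split=> [|x y] /=.
  by have := band_glue bd; rewrite gE; lia.
have lux : l x < u x by apply: leq_ltn_trans (band_l bd x) (band_lu bd x).
apply/imfset2P/idP.
  case=> -[a b] /=; rewrite memX => ab [t ts [-> ->]].
  by have : t \in iota 0 s.+1 := ts; rewrite mem_iota; lia.
(* a cell above column [x] of [X] is reached from the top cell of that column *)
move=> xy; exists (x, minn y (u x).-1) => /=; first by rewrite memX; lia.
exists (y - (u x).-1); last by congr (_, _); lia.
change (y - (u x).-1 \in iota 0 s.+1); rewrite mem_iota; lia.
Qed.

Lemma window_erode s w h l u X :
    (forall i, l i < u i) -> window w h l (fun i => u i + s) X -> h < u w.-1 ->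
  window w h l u (erode s X).
Proof.
move=> lu [gE memX] hu; split=> [|x y] /=; first by rewrite gE; lia.
by rewrite !inE /= !memX; case: ltnP => //= _; lia.
Qed.

Lemma thicken_rotation s X :
  is_ppp X -> thicken s (rotation X) = rotation (thicken s X).
Proof.
case/pppP=> w [h [l [u [bd win]]]].
have winr := window_thicken s (band_next bd) (rotation_window bd win).
have := rotation_window (band_thicken s bd) (window_thicken s bd win).
suff -> : next_col (l 1) (fun i => u i + s) = (fun i => next_col (l 1) u i + s).
  exact: window_inj winr.
apply/funext => i; rewrite /next_col addnBAC //.
have := leq_homo (band_l bd) (ltn0Sn i); have := band_l bd i.+1.
by have := band_lu bd i.+1; lia.
Qed.

(** The amount of thickening depends on the width, so that the area always
increases by [L]. *)
Definition stretch (L : nat) (X : glued) : glued := thicken (L %/ width X) X.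
Definition shrink (L : nat) (X : glued) : glued := erode (L %/ width X) X.

Section Stretch.

Variables n L : nat.
Hypothesis dvdL : forall i, 0 < i < n -> i %| L.

Lemma width_stretch X : is_ppp X -> width (stretch L X) = width X.
Proof.
case/pppP=> w [h [l [u [bd win]]]].
rewrite (width_window bd win).
exact: width_window (band_thicken _ bd) (window_thicken _ bd win).
Qed.

Lemma stretchK X : is_ppp X -> shrink L (stretch L X) = X.
Proof.
move=> pX; rewrite /shrink width_stretch // /stretch.
case/pppP: pX => w [h [l [u [bd win]]]].
apply: window_inj (win); apply: window_erode (band_glue bd).
  by move=> i; apply: leq_ltn_trans (band_l bd i) (band_lu bd i).
exact: window_thicken bd win.
Qed.

Lemma stretch_rotation X :
  is_ppp X -> stretch L (rotation X) = rotation (stretch L X).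
Proof.
move=> pX; rewrite /stretch -thicken_rotation //; congr thicken.
case/pppP: pX => w [h [l [u [bd win]]]].
by rewrite (width_window (band_next bd) (rotation_window bd win))
           (width_window bd win).
Qed.

Lemma sum_thicken w s (l u : nat -> nat) : (forall i, l i < u i) ->
  \sum_(0 <= x < w) (u x + s - l x) = \sum_(0 <= x < w) (u x - l x) + s * w.
Proof.
have -> : s * w = \sum_(0 <= x < w) s by rewrite sum_nat_const_nat subn0 mulnC.
move=> lu; rewrite -big_split /=.
by apply: eq_bigr => x _; have := lu x; lia.
Qed.

Lemma ppps_band m X : ppps n m X -> exists w h l u,
  [/\ band w h l u, window w h l u X, h + w = n,
      \sum_(0 <= x < w) (u x - l x) = m & width X = w].
Proof.
case=> /pppP[w [h [l [u [bd win]]]]] spX aX; exists w, h, l, u.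
by rewrite -(semi_perimeter_window bd win) -(area_window bd win)
           (width_window bd win).
Qed.

Lemma dvdn_width m X : ppps n m X -> width X %| L.
Proof.
case/ppps_band=> w [h [l [u [bd _ hw _ ->]]]]; apply: dvdL.
by have := band_w bd; have := band_h bd; lia.
Qed.

Lemma ppps_stretch m X : ppps n m X -> ppps n (m + L) (stretch L X).
Proof.
move=> SX; have wL := dvdn_width SX.
have [w [h [l [u [bd win hw aX wX]]]]] := ppps_band SX.
rewrite wX in wL.
have bd' := band_thicken (L %/ w) bd.
have win' := window_thicken (L %/ w) bd win.
rewrite /stretch wX; split; first exact: is_ppp_window bd' win'.
  by rewrite (semi_perimeter_window bd' win').
rewrite (area_window bd' win') sum_thicken ?aX ?divnK // => i.
exact: leq_ltn_trans (band_l bd i) (band_lu bd i).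
Qed.

(** For columns [i] and [x] below [w], [u x <= u (i + w) = u i + h].  If
[u i <= l (i + 1) + s <= h + s], then all columns have at most [2 h + s] cells,
and the area is at most [2 h w + s w <= 2 n n + L], less than [m + L].  So the
upper boundary can be lowered by [s]. *)
Lemma ppps_shrink m Y : 2 * n * n < m -> ppps n (m + L) Y ->
  exists2 X, ppps n m X & Y = stretch L X.
Proof.
move=> m_big SY; have wL := dvdn_width SY.
have [w [h [l [u [bd win hw aY wY]]]]] := ppps_band SY.
rewrite wY in wL; set s := L %/ w; have sw : s * w = L by apply: divnK.
have [w_gt0 h_gt0 l0 lP uP lu lper uper] := bd.
have thick0 i : i < w -> l i.+1 + s < u i.
  move=> iw; rewrite ltnNge; apply/negP => u_small.
  have li : l i.+1 <= h by rewrite -(band_lw bd); apply: leq_homo.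
  have : \sum_(0 <= x < w) (u x - l x) <= \sum_(0 <= x < w) (2 * h + s).
    rewrite big_nat [leqRHS]big_nat; apply: leq_sum => x /andP[_ xw].
    have := leq_homo uP (leq_trans (ltnW xw) (leq_addl i w)).
    by rewrite uper; lia.
  rewrite aY sum_nat_const_nat subn0 mulnDr [w * s]mulnC sw leq_add2r.
  have : w * (2 * h) <= n * (2 * n) by apply: leq_mul; lia.
  by move: m_big; rewrite -mulnA mulnCA; lia.
have thick i : l i.+1 + s < u i.
  rewrite (divn_eq i w); elim: (i %/ w) => [|q IHq].
    by rewrite add0n; apply: thick0; rewrite ltn_pmod.
  by rewrite mulSn -addnA [w + _]addnC -[(_ + w).+1]addSn lper uper; lia.
have su i : s <= u i by have := thick i; lia.
have bdX : band w h l (fun i => u i - s).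
  split=> // i; first exact: leq_sub2r.
    by have := thick i; lia.
  by rewrite uper addnBAC.
have lu' i : l i < u i - s by apply: leq_ltn_trans (lP i) (band_lu bdX i).
have uE : (fun i => u i - s + s) = u by apply/funext => i; rewrite subnK.
have winX : window w h l (fun i => u i - s) (erode s Y).
  by apply: window_erode (band_glue bdX) => //; rewrite uE.
exists (erode s Y); last first.
  rewrite /stretch (width_window bdX winX); apply: window_inj win _.
  by have := window_thicken s bdX winX; rewrite uE.
split; first exact: is_ppp_window bdX winX.
  by rewrite (semi_perimeter_window bdX winX).
rewrite (area_window bdX winX); apply/eqP.
rewrite -(eqn_add2r L) -aY -sw -sum_thicken //; apply/eqP.
by apply: eq_bigr => x _; rewrite subnK.
Qed.

Lemma ppps_addL m : 2 * n * n < m ->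
  ppps n (m + L) = (stretch L @` ppps n m)%classic.
Proof.
move=> m_big; apply/seteqP; split=> [Y /(ppps_shrink m_big)[X SX ->]|Y].
  by exists X.
by case=> X SX <-; apply: ppps_stretch.
Qed.

Lemma ppps_card m : 2 * n * n < m -> (ppps n (m + L) #= ppps n m)%card.
Proof.
move=> m_big; rewrite ppps_addL //; apply: inj_card_eq => X Y.
rewrite !inE => -[pX _ _] [pY _ _] /(congr1 (shrink L)).
by rewrite !stretchK.
Qed.

(** The mark keeps its distance to the top of the first column, and to the top
of the gluing. *)
Definition stretch_marked (Y : glued * nat) : glued * nat :=
  (stretch L Y.1, Y.2 + L %/ width Y.1).

Lemma col_height_thicken s X : is_ppp X ->
  col_height (thicken s X).1 0 = col_height X.1 0 + s.
Proof.
case/pppP=> w [h [l [u [bd win]]]].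
rewrite (col_height_profile (window_profile bd win)) ?(band_w bd) //.
have bd' := band_thicken s bd; have win' := window_thicken s bd win.
rewrite (col_height_profile (window_profile bd' win')) ?(band_w bd) //.
by rewrite (band_l0 bd) !subn0.
Qed.

Lemma marked_ppps_addL m : 2 * n * n < m ->
  marked_ppps n (m + L) = (stretch_marked @` marked_ppps n m)%classic.
Proof.
move=> m_big; apply/seteqP; split.
  move=> [Y j] [[/= pY jY] spY aY].
  have [|X SX YE] := @ppps_shrink m Y m_big; first by split.
  have [pX spX aX] := SX.
  move: jY; rewrite YE col_height_thicken //= => /andP[gj jg].
  exists (X, j - L %/ width X).
    by split=> //; split=> //=; lia.
  by rewrite /stretch_marked /= subnK //; lia.
move=> _ [[X j] [[/= pX jX] spX aX] <-].
have [//|pX' spX' aX'] := @ppps_stretch m X.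
split=> //; split=> //=.
by rewrite col_height_thicken //= !leq_add2r.
Qed.

Lemma marked_ppps_card m : 2 * n * n < m ->
  (marked_ppps n (m + L) #= marked_ppps n m)%card.
Proof.
move=> m_big; rewrite marked_ppps_addL //; apply: inj_card_eq => -[X i] [Y j].
rewrite !inE => -[[/= pX _] _ _] [[/= pY _] _ _] XY.
have XE : X = Y.
  by move/(congr1 (fun Z => shrink L Z.1)): XY; rewrite /= !stretchK.
by move/(congr1 snd): XY; rewrite XE /= => /addIn ->.
Qed.

Lemma iter_rotation_ppp k X : is_ppp X -> is_ppp (iter k rotation X).
Proof. by move=> pX; elim: k => //= k; apply: is_ppp_rotation. Qed.

Lemma orbit_stretch X : is_ppp X ->
  orbit_of (stretch L X) = (stretch L @` orbit_of X)%classic.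
Proof.
move=> pX.
have comm k :
    iter k rotation (stretch L X) = stretch L (iter k rotation X).
  by elim: k => //= k ->; rewrite stretch_rotation //; apply: iter_rotation_ppp.
apply/seteqP; split=> [_ [k ->]|_ [_ [k ->] <-]].
  by exists (iter k rotation X) => //; exists k.
by exists k.
Qed.

(** The left inverse of [stretch L] acts on orbits too, which makes the induced
map on strips injective. *)
Lemma shrink_orbit X : is_ppp X ->
  (shrink L @` (stretch L @` orbit_of X) = orbit_of X)%classic.
Proof.
move=> pX; apply/seteqP; split.
  move=> _ [_ [_ [k ->] <-] <-]; exists k.
  by rewrite stretchK //; apply: iter_rotation_ppp.
move=> _ [k ->]; exists (stretch L (iter k rotation X)).
  by exists (iter k rotation X) => //; exists k.
by rewrite stretchK //; apply: iter_rotation_ppp.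
Qed.

Lemma strips_card m : 2 * n * n < m -> (strips n (m + L) #= strips n m)%card.
Proof.
move=> m_big; pose F (O : set glued) := (stretch L @` O)%classic.
have -> : strips n (m + L) = (F @` strips n m)%classic.
  apply/seteqP; split.
    move=> _ [Y /(ppps_shrink m_big)[X SX ->] ->].
    exists (orbit_of X); first by exists X.
    by rewrite orbit_stretch //; case: SX.
  move=> _ [_ [X SX ->] <-]; exists (stretch L X); first exact: ppps_stretch.
  by rewrite orbit_stretch //; case: SX.
apply: inj_card_eq => O1 O2; rewrite !inE => -[X [pX _ _] ->] [Y [pY _ _] ->].
rewrite /F => /(congr1 (fun O => shrink L @` O)%classic).
by rewrite !shrink_orbit.
Qed.

End Stretch.

(** * Finiteness and eventual periods *)

(** A PPP of semi-perimeter [n] and area [m] has at most [n] columns and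
[n + m] rows, since its gluing size is at most its area. *)
Lemma finite_ppps n m : finite_set (ppps n m).
Proof.
pose box := fpowerset ([fset x in iota 0 n] `*` [fset y in iota 0 (n + m)]).
apply: (@sub_finite_set _ _ ([set` box] `*` `I_m.+1)%classic); last first.
  by apply: finite_setX; [exact: finite_fset | exact: finite_II].
move=> [P g] /ppps_band[w [h [l [u [bd [/= gE memP] hw aX _]]]]].
have := band_glue bd; have := band_h bd; have := band_u bd w.-1.
rewrite prednK ?(band_w bd) // (band_uw bd) => uw h_gt0 gl.
have u0 : u 0 <= m.
  by rewrite -aX big_ltn ?(band_w bd) // (band_l0 bd) subn0 leq_addr.
split=> /=; last by lia.
rewrite fpowersetE; apply/fsubsetP => -[x y]; rewrite memP => /and3P[xw _ yu].
have xw1 : x <= w.-1 by lia.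
have := leq_homo (band_u bd) xw1.
by rewrite !inE /= !mem_iota; lia.
Qed.

Lemma finite_marked_ppps n m : finite_set (marked_ppps n m).
Proof.
apply: (@sub_finite_set _ _ (ppps n m `*` `I_m.+1)%classic); last first.
  by apply: finite_setX; [exact: finite_ppps | exact: finite_II].
move=> [X j] [[/= pX /andP[_ jX]] spX aX]; split=> //=.
have [|w [h [l [u [bd win _ areaX _]]]]] := @ppps_band n m X; first by split.
rewrite ltnS; apply: leq_trans jX _.
rewrite (col_height_profile (window_profile bd win)) ?(band_w bd) //.
by rewrite -areaX big_ltn ?(band_w bd) // leq_addr.
Qed.

Lemma finite_strips n m : finite_set (strips n m).
Proof.
suff -> : strips n m = (orbit_of @` ppps n m)%classic.
  exact/finite_image/finite_ppps.
by apply/seteqP; split=> [_ [X SX ->]|_ [X SX <-]]; exists X.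
Qed.

Lemma exists_gf_coefs T (S : nat -> set T) :
  (forall m, finite_set (S m)) -> exists a, gf_coefs S a.
Proof. by move=> /choice[a aP]; exists a. Qed.

Lemma gf_coefs_period T (S : nat -> set T) a L M : gf_coefs S a -> 0 < L ->
  (forall m, M < m -> (S (m + L) #= S m)%card) -> eventual_period a L.
Proof.
move=> aP L_gt0 SL; split=> //; exists M.+1 => m Mm; apply/card_eq_II.
apply: card_eq_trans (aP m); apply: card_eq_trans (SL m Mm).
by rewrite card_eq_sym.
Qed.

(** The remainder of [L] modulo [T] is an eventual period if it is not [0]. *)
Lemma is_period_dvdn a T L : is_period a T -> eventual_period a L -> T %| L.
Proof.
case=> -[T_gt0 [M aT]] minT [_ [M' aL]].
have aqT q m : M <= m -> a (m + q * T) = a m.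
  move=> Mm; elim: q => [|q IHq]; first by rewrite addn0.
  by rewrite mulSn addnCA addnC aT ?IHq // (leq_trans Mm) ?leq_addr.
rewrite /dvdn; case: posnP => // r_gt0.
have : eventual_period a (L %% T).
  split=> //; exists (maxn M M') => m; rewrite geq_max => /andP[Mm M'm].
  rewrite -(aqT (L %/ T)) ?(leq_trans Mm) ?leq_addr //.
  by rewrite -addnA [L %% T + _]addnC -divn_eq aL.
by move/minT; rewrite leqNgt ltn_pmod.
Qed.

Lemma lcm_products_gt0 n : 0 < lcm_products n.
Proof.
rewrite /lcm_products big_nat; elim/big_rec: _ => // i L /andP[i_gt0 i_lt] L_gt0.
by rewrite lcmn_gt0 muln_gt0 i_gt0 subn_gt0 i_lt.
Qed.

Lemma dvdn_lcm_products n i : 0 < i < n -> i %| lcm_products n.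
Proof.
move=> i_in; apply: (@dvdn_trans (i * (n - i))); first exact: dvdn_mulr.
rewrite /lcm_products (bigD1_seq i) ?iota_uniq ?mem_index_iota //=.
exact: dvdn_lcml.
Qed.

Theorem corollary4p3 (n : nat) :
  exists A B C : nat -> nat,
    [/\ gf_coefs (ppps n) A, gf_coefs (marked_ppps n) B &
        gf_coefs (strips n) C] /\
    [/\ ultimately_periodic A, ultimately_periodic B &
        ultimately_periodic C] /\
    (forall T : nat, is_period A T \/ is_period B T \/ is_period C T ->
       T %| lcm_products n).
Proof.
have [A gfA] := exists_gf_coefs (finite_ppps n).
have [B gfB] := exists_gf_coefs (finite_marked_ppps n).
have [C gfC] := exists_gf_coefs (finite_strips n).
have L_gt0 := lcm_products_gt0 n; have dvdL := @dvdn_lcm_products n.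
have pA := gf_coefs_period gfA L_gt0 (ppps_card dvdL).
have pB := gf_coefs_period gfB L_gt0 (marked_ppps_card dvdL).
have pC := gf_coefs_period gfC L_gt0 (strips_card dvdL).
exists A, B, C; split=> //; split; first by split; exists (lcm_products n).
by move=> T [|[]] perT; apply: is_period_dvdn perT _.
Qed.
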